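(* Let $Q$ and $Q'$ be two non-zero irreducible monomial ideals of $S=K[x_1,\ldots,x_n]$. Then $$\operatorname{sdepth}_S(Q\cap Q')\geq \dim(S/(Q+Q'))+\left\lceil\frac{\dim(S/Q')-\dim(S/(Q+Q'))}{2}\right\rceil+\left\lceil\frac{\dim(S/Q)-\dim(S/(Q+Q'))}{2}\right\rceil\geq \left\lceil\frac{\dim(S/Q')+\dim(S/Q)}{2}\right\rceil.$$
   Context: $K$ is a field and $S=K[x_1,\ldots,x_n]$ with its standard $\mathbb{Z}^n$-grading (multigrading). A monomial ideal is irreducible if it is generated by powers of some of the variables. For a finitely generated multigraded $S$-module $M$, a homogeneous element $z\in M$ and $Z\subseteq\{x_1,\ldots,x_n\}$, let $zK[Z]\subset M$ be the $K$-subspace of all elements $zf$, $f\in K[Z]$; it is called a Stanley space of dimension $|Z|$ if it is a free $K[Z]$-module. A Stanley decomposition of $M$ is a presentation of the $K$-vector space $M$ as a finite direct sum of Stanley spaces $\mathcal{D}: M=\bigoplus_{i=1}^r z_iK[Z_i]$. Set $\operatorname{sdepth}\mathcal{D}=\min\{|Z_i|: i=1,\ldots,r\}$, and $\operatorname{sdepth}_S(M)=\operatorname{sdepth}(M)=\max\{\operatorname{sdepth}\mathcal{D}:\mathcal{D}\text{ a Stanley decomposition of }M\}$ (the Stanley depth of $M$). $\lceil a\rceil$ is the smallest integer $\geq a$. *)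

(* Defs.v *)
From HB Require Import structures.
From mathcomp Require Import all_boot all_order all_algebra.
From mathcomp Require Export boolp classical_sets.
From mathcomp Require Export mpoly.

Set Implicit Arguments.
Unset Strict Implicit.
Unset Printing Implicit Defensive.

Import GRing.Theory.
Local Open Scope classical_set_scope.
Local Open Scope ring_scope.

Section Ideals.
Variable R : comNzRingType.
Implicit Types (I J P G : set R).

(* Unlike [idealr_closed], this does not require 1 to lie outside of I. *)
Definition is_ideal I : Prop :=
  I 0 /\ forall a u v, I u -> I v -> I (a * u + v).

Definition ideal_gen G : set R := smallest is_ideal G.

Definition ideal_add I J : set R := [set u + v | u in I & v in J].

(* [idealr_closed] includes properness. *)
Definition is_prime P : Prop :=
  idealr_closed (mem P) /\ prime_idealr_closed (mem P).

(* C 0, ..., C d is a chain of length d; C i is irrelevant for i > d. *)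
Definition prime_chain (d : nat) (C : nat -> set R) : Prop :=
  (forall i, (i <= d)%N -> is_prime (C i)) /\
  (forall i, (i < d)%N -> C i `<` C i.+1).

Definition is_krull_dim (d : nat) : Prop :=
  (exists C, prime_chain d C) /\
  (forall e C, prime_chain e C -> (e <= d)%N).

(* Krull dimension, with the junk value 0 if it is infinite. *)
Definition krull_dim : nat := xget 0%N [set d | is_krull_dim d].

End Ideals.

Section QuotientRing.
Variables (R : comNzRingType) (I : set R) (hI : idealr_closed (mem I)).

(* The unused argument lets the Idealr instance be inferred. *)
Definition ideal_pred of idealr_closed (mem I) : R -> bool := fun x => x \in I.

HB.instance Definition _ := isIdealr.Build R (ideal_pred hI) hI.

Definition quot_ring : comNzRingType := {ideal_quot (ideal_pred hI : idealr R)}.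

End QuotientRing.

(* The dimension of the ring R / I; the value for I = R (where R / I is the
   zero ring) is a junk value. *)
Definition quot_dim (R : comNzRingType) (I : set R) : nat :=
  if pselect (idealr_closed (mem I)) is left hI then krull_dim (quot_ring hI)
  else 0%N.

Section MonomialIdeals.
Variables (K : fieldType) (n : nat).
Local Notation S := {mpoly K[n]}.
Implicit Types (M Q : set S) (Z : {set 'I_n}).

(* The exponents are positive, so that an irreducible ideal is proper; the
   zero ideal corresponds to A = set0. *)
Definition irreducible_monomial_ideal Q : Prop :=
  exists (A : {set 'I_n}) (a : 'I_n -> nat),
    (forall i, i \in A -> (0 < a i)%N) /\
    Q = ideal_gen [set f | exists2 i, i \in A & f = 'X_i ^+ a i].

(* The nonzero components of the Z^n-grading of S are the lines K x^m. *)
Definition multihomogeneous (z : S) : Prop :=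
  exists (c : K) (m : 'X_{1..n}), z = c *: 'X_[m].

(* K[Z], as a subset of S *)
Definition polys_in Z : set S :=
  [set f | forall m, m \in msupp f -> forall i, i \notin Z -> m i = 0%N].

Definition zK (z : S) Z : set S := [set z * f | f in polys_in Z].

(* zK[Z] is a free K[Z]-module, with basis z. *)
Definition is_stanley_space M (z : S) Z : Prop :=
  [/\ M z, multihomogeneous z & forall f, polys_in Z f -> z * f = 0 -> f = 0].

(* M is meant to be a multigraded S-submodule of S, i.e. a monomial ideal. *)
Definition stanley_decomposition M (r : nat)
    (z : 'I_r -> S) (Z : 'I_r -> {set 'I_n}) : Prop :=
  [/\ forall i, is_stanley_space M (z i) (Z i),
      M = [set p | exists2 w : 'I_r -> S,
                     forall i, zK (z i) (Z i) (w i) & p = \sum_i w i]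
    & forall w : 'I_r -> S, (forall i, zK (z i) (Z i) (w i)) ->
        \sum_i w i = 0 -> forall i, w i = 0].

(* The default n is an upper bound for all #|Z i|; it only matters for the
   empty decomposition, i.e. for M = 0. *)
Definition sdepth_decomposition (r : nat) (Z : 'I_r -> {set 'I_n}) : nat :=
  \big[minn/n]_(i < r) #|Z i|.

(* All the values sdepth D are at most n. *)
Definition sdepth M : nat :=
  (\max_(k < n.+1 | `[< exists (r : nat) (z : 'I_r -> S)
                          (Z : 'I_r -> {set 'I_n}),
                        stanley_decomposition M z Z /\
                        sdepth_decomposition Z = k >]) k)%N.

End MonomialIdeals.

(* Main.v *)
Require Import Defs.
From HB Require Import structures.
From mathcomp Require Import all_boot all_order all_algebra.
From mathcomp Require Import zify lra.

(** Let Q be generated by the powers X_i ^ a_i, i in A, and Q' by the powers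
    X_i ^ b_i, i in B.  The dimensions of S/Q, S/Q' and S/(Q + Q') are n - |A|,
    n - |B| and n - |A u B|, so that the lower bound reads
    n - |A u B| + ceil(|A - B| / 2) + ceil(|B - A| / 2), and comparing it with
    ceil((dim S/Q + dim S/Q') / 2) is arithmetic.

    Dimensions ([quot_dim_coord]).  For the lower bound one kills the variables
    outside A one by one.  For the upper bound take a chain of primes
    P_0 < ... < P_k above an ideal that contains a power of X_i for each i in A, and
    elements x_i of P_(i+1) outside P_i.  The monomials in x_0, ..., x_(k-1) with
    exponents less than N are linearly independent modulo P_0
    ([prime_chain_indep]), there are N ^ k of them, their degree is at most D * N
    for some D that does not depend on N, and modulo P_0 they are polynomials in
    n - |A| variables ([card_indep_mod]).  Letting N grow yields k <= n - |A|.

    Stanley depth ([sdepth_some_ge_capI]).  It suffices to partition the monomials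
    of the intersection of Q and Q' into boxes v + N^Z with Z large
    ([sdepth_ge_box_partition]).  A monomial m belongs to the ideal generated by the
    X_i ^ a_i, i in P, if and only if the set T of all i in P with a_i <= m_i is
    nonempty.  A partition of the nonempty subsets of P into intervals [X, Y]
    therefore gives a partition into boxes: on an interval the exponent is
    arbitrary at Y - X, at least a_i at X, and one of the values less than a_i
    outside Y.  This is used for A - B and for B - A, independently of each other;
    the exponents at the common variables are kept fixed (up to a bound from which
    on they are free), and decide which of the two membership conditions is
    already satisfied.

    So everything rests on a partition of the nonempty subsets of P into intervals
    [X, Y] with |Y| >= |P| / 2, which is a theorem of Biro, Howard, Keller, Trotter
    and Young.  It is obtained here as follows.  Write T, not
    empty, as a binary word on a circle of odd length.  There is exactly one way to cut the circular word into
    blocks of the form 1 and 0*, where * stands for any letter: reading a 1 always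
    leads to the beginning of a block, so the parse does not depend on where it
    starts ([cyclic_state_uniq]).  The sets whose word has the same parse form
    an interval ([interval_state], [interval_stable]): the starred letters are free,
    all others are prescribed.  Its top contains everything but the zeros that open
    a block 0*, hence at least half of the circle ([card_interval_top]).  The empty
    word is in no such interval, because a circle of odd length is not a union of
    blocks of length two ([interval_neq0]). *)

Set Implicit Arguments.
Unset Strict Implicit.
Unset Printing Implicit Defensive.

Import Order.TTheory GRing.Theory Num.Theory.
Local Open Scope classical_set_scope.
Local Open Scope ring_scope.

(** * Parsing a cyclic binary word *)

Section CyclicParsing.
Local Open Scope nat_scope.

(** Reading a binary word from left to right, a letter [1] met at the start of a
    block is a block by itself, while a letter [0] met there forms a block with
    the next letter, whatever that letter is.  The value at [p] tells whether a
    block starts at position [p] (otherwise [p] is the second letter of a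
    block). *)
Fixpoint parse_state (t : nat -> bool) (e : bool) (p : nat) : bool :=
  if p is p'.+1 then ~~ parse_state t e p' || t p' else e.

(** After a letter [1] a block starts, in whichever state that letter was read:
    the second letter of a block ends it too. *)
Lemma parse_state_sync (t : nat -> bool) e e' p q :
  p < q -> t p -> parse_state t e q = parse_state t e' q.
Proof.
elim: q => // q IHq; rewrite ltnS leq_eqVlt => /orP[/eqP<- tp|/IHq{}IHq /IHq/= ->//].
by rewrite /= tp !orbT.
Qed.

(** By synchronization, a word of length [N] with a letter [1] ends in the same
    state wherever one starts from; starting in that state parses the word
    written on a circle. *)
Definition cyclic_state (N : nat) (t : nat -> bool) : nat -> bool :=
  parse_state t (parse_state t true N).

Lemma cyclic_stateS N (t : nat -> bool) p :
  cyclic_state N t p.+1 = ~~ cyclic_state N t p || t p.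
Proof. by []. Qed.

Lemma cyclic_state_wrap N (t : nat -> bool) p :
  p < N -> t p -> cyclic_state N t N = cyclic_state N t 0.
Proof. by move=> pN tp; apply: parse_state_sync tp. Qed.

Lemma cyclic_state_uniq N (t s : nat -> bool) p0 :
  p0 < N -> t p0 -> s N = s 0 -> (forall p, p < N -> s p.+1 = ~~ s p || t p) ->
  forall p, p <= N -> s p = cyclic_state N t p.
Proof.
move=> p0N tp0 sN sS.
(* s is the parse that starts in its own initial state. *)
have sE : forall p, p <= N -> s p = parse_state t (s 0) p.
  by elim=> // p IHp pN; rewrite sS //= IHp // ltnW.
move=> p pN; rewrite sE // /cyclic_state; congr (parse_state t _ p).
by rewrite -sN sE //; apply: parse_state_sync tp0.
Qed.

(** Without the letter [1] the two states alternate, which cannot close up around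
    a circle of odd length. *)
Lemma alternating_iter (s : nat -> bool) N :
  (forall p, p < N -> s p.+1 = ~~ s p) -> s N = s 0 (+) odd N.
Proof.
elim: N => [|N IHN] sS; first by rewrite addbF.
by rewrite sS // IHN => [|p pN]; [rewrite addbN|rewrite sS // ltnW].
Qed.

(** Each position where no block starts follows one where a block starts, so the
    latter are at least half of the positions. *)
Lemma count_no_two_false (s : nat -> bool) N :
  s N = s 0 -> (forall p, p < N -> ~~ s p -> s p.+1) -> odd N ->
  N./2.+1 <= \sum_(p < N) s p.+1.
Proof.
move=> sN sS oddN.
have h : \sum_(p < N) s p.+1 = \sum_(p < N) s p.
  apply/eqP; rewrite -(eqn_add2l (s 0)); apply/eqP.
  by rewrite -[LHS](big_ord_recl N (fun p => nat_of_bool (s p))) big_ord_recr /= sN addnC.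
have : N <= \sum_(p < N) (s p + s p.+1).
  rewrite -[leqLHS]card_ord -sum1_card; apply: leq_sum => i _.
  by case: (boolP (s i)) => // /(sS _ (ltn_ord i))->.
rewrite big_split /= -h; move: (\sum_(p < N) _) => m; rewrite addnn => Nm.
by rewrite -(odd_double_half N) oddN add1n ltn_double in Nm.
Qed.

End CyclicParsing.

(** * Partition of the nonempty subsets of a finite set into large intervals *)

Section IntervalPartition.
Local Open Scope nat_scope.
Variables (I : finType) (P : {set I}).
Implicit Types T : {set I}.

(* The elements of P are placed on a circle of odd length N; when #|P| is even,
   the last position stays unoccupied. *)
Let N := (#|P|./2).*2.+1.
Let member_at T (p : nat) : bool := p \in [seq index i (enum P) | i in T].
Let pos i := index i (enum P).
Let state T := cyclic_state N (member_at T).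

(** The parse of [T] only constrains the letters at which a block starts: the
    one-letter blocks have to be [1] and the first letters of the two-letter
    blocks [0].  A one-letter block sits at [p] when blocks start at [p] and at
    [p.+1], and the forced zeros are the positions [p] such that no block starts
    at [p.+1]. *)
Definition interval_bot (T : {set I}) : {set I} :=
  [set i in P | state T (pos i) && state T (pos i).+1].
Definition interval_top (T : {set I}) : {set I} :=
  [set i in P | state T (pos i).+1].

Lemma member_at_pos T i : i \in P -> T \subset P -> member_at T (pos i) = (i \in T).
Proof.
move=> iP TP; apply/mapP/idP => [[j]|iT]; last by exists i; rewrite ?mem_enum.
rewrite mem_enum => jT /(congr1 (nth i (enum P))).
by rewrite !nth_index ?mem_enum // => [->|]; rewrite ?(subsetP TP).
Qed.

Lemma member_atP T p : T \subset P ->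
  reflect (exists2 i, i \in T & p = pos i) (member_at T p).
Proof.
move=> TP; apply: (iffP mapP) => [][i]; rewrite ?mem_enum => iT ->; exists i => //.
by rewrite mem_enum.
Qed.

Lemma pos_lt i : i \in P -> pos i < N.
Proof.
move=> iP; apply: (@leq_trans #|P|); last by rewrite /N; lia.
by rewrite cardE index_mem mem_enum.
Qed.

Lemma interval_bot_sub T : T \subset P -> interval_bot T \subset T.
Proof.
move=> TP; apply/subsetP => i; rewrite inE => /and3P[iP].
by rewrite /state cyclic_stateS => ->; rewrite /= member_at_pos.
Qed.

Lemma interval_top_sup T : T \subset P -> T \subset interval_top T.
Proof.
move=> TP; apply/subsetP => i iT; have iP := subsetP TP _ iT.
by rewrite inE iP /state cyclic_stateS member_at_pos // iT orbT.
Qed.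

Lemma interval_top_sub T : interval_top T \subset P.
Proof. by apply/subsetP => i; rewrite inE => /andP[]. Qed.

Lemma state_wrap T : T \subset P -> T != set0 -> state T N = state T 0.
Proof.
move=> TP /set0Pn[i iT]; have iP := subsetP TP _ iT.
by apply: (@cyclic_state_wrap _ _ (pos i)); rewrite ?pos_lt ?member_at_pos.
Qed.

(** The words of the interval of [T] obey the same parse: where a block starts the
    interval prescribes the letter of [T], and elsewhere a block ends whatever
    the letter is. *)
Lemma interval_state T T' : T \subset P ->
  interval_bot T \subset T' -> T' \subset interval_top T ->
  forall p, state T p.+1 = ~~ state T p || member_at T' p.
Proof.
move=> TP botT' T'top p; have T'P := subset_trans T'top (interval_top_sub T).
have Sp : state T p.+1 = ~~ state T p || member_at T p by [].
case sp: (state T p); rewrite Sp sp //=.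
apply/idP/idP => [tp|/(member_atP _ T'P)[i iT' pi]].
  have /(member_atP _ TP)[i iT pi] := tp.
  have iP := subsetP TP _ iT.
  rewrite pi member_at_pos // (subsetP botT') // inE iP -pi sp.
  by rewrite Sp tp orbT.
by have := subsetP T'top _ iT'; rewrite inE -pi Sp sp => /andP[].
Qed.

Lemma interval_neq0 T T' : T \subset P -> T != set0 ->
  interval_bot T \subset T' -> T' \subset interval_top T -> T' != set0.
Proof.
move=> TP T0 botT' T'top; apply/eqP => T'0.
(* If the empty word obeyed the parse of T, the states would alternate. *)
have alt p : p < N -> state T p.+1 = ~~ state T p.
  rewrite (interval_state TP botT' T'top) T'0 => _.
  rewrite (_ : member_at _ _ = false) ?orbF //.
  by apply/negbTE/negP => /mapP[i]; rewrite mem_enum inE.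
have := alternating_iter alt; rewrite state_wrap // /N /= odd_double.
by case: state.
Qed.

(** A word has only one cyclic parse, so all members of the interval of [T] have
    the interval of [T]: these intervals partition the nonempty subsets. *)
Lemma interval_stable T T' : T \subset P -> T != set0 ->
  interval_bot T \subset T' -> T' \subset interval_top T ->
  interval_bot T' = interval_bot T /\ interval_top T' = interval_top T.
Proof.
move=> TP T0 botT' T'top; have T'P := subset_trans T'top (interval_top_sub T).
have /set0Pn[i iT'] := interval_neq0 TP T0 botT' T'top.
have iP := subsetP T'P _ iT'.
have sE : forall p, p <= N -> state T p = state T' p.
  apply: (@cyclic_state_uniq _ _ _ (pos i)); rewrite ?pos_lt ?member_at_pos ?state_wrap //.
  by move=> p _; apply: interval_state.
split; apply/setP => j; rewrite !inE; case jP: (j \in P) => //=;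
  by rewrite !sE // ?pos_lt // ltnW // pos_lt.
Qed.

(** The top consists of the positions followed by the start of a block, hence of
    at least [(N + 1) / 2] positions; one of them may be the unoccupied one, but
    only when #|P| is even. *)
Lemma card_interval_top T : T \subset P -> T != set0 ->
  uphalf #|P| <= #|interval_top T|.
Proof.
move=> TP T0.
have oddN : odd N by rewrite /N /= odd_double.
have := @count_no_two_false (state T) N (state_wrap TP T0) _ oddN.
rewrite /= => /(_ _)/wrap[p _ np|]; first by rewrite /state cyclic_stateS np.
have -> : #|interval_top T| = \sum_(p < #|P|) state T p.+1.
  rewrite -sum1_card (eq_bigl (fun i => (i \in P) && state T (pos i).+1)); last first.
    by move=> i; rewrite inE.
  rewrite big_mkcondr big_enum_val /=; apply: eq_bigr => i _.
  by rewrite /pos (enum_val_nth (enum_val i)) index_uniq ?enum_uniq -?cardE.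
rewrite uphalf_double /N; case: (boolP (odd #|P|)) => [oddP|evenP].
  by rewrite (_ : (_./2).*2.+1 = #|P|) ?uphalf_half ?oddP //; lia.
rewrite (_ : (_./2).*2 = #|P|); last by lia.
rewrite big_ord_recr uphalf_half (negbTE evenP) add0n => topN.
by rewrite -(leq_add2r 1) addn1; apply: leq_trans topN _; rewrite leq_add2l leq_b1.
Qed.
End IntervalPartition.

(** * Stanley decompositions from partitions of monomials into boxes *)

Section SupportSpaces.
Variables (K : fieldType) (n : nat).
Local Notation S := {mpoly K[n]}.
Implicit Types (mon : pred 'X_{1..n}) (v m : 'X_{1..n}) (Z : {set 'I_n}) (f g : S).

(** For [mon] stable under multiplication by monomials this is the monomial ideal
    spanned by [mon]; for a box it is a Stanley space. *)
Definition supp_in mon : set S := [set f | forall m, m \in msupp f -> mon m].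

Lemma supp_in0 mon : supp_in mon 0.
Proof. by move=> m; rewrite msupp0. Qed.

Lemma supp_inP mon f : supp_in mon f <-> forall m, ~~ mon m -> f@_m = 0.
Proof.
split=> [hf m|hf m]; first by apply: contraNeq; rewrite -mcoeff_msupp => /hf.
by rewrite mcoeff_msupp; apply: contraNT => /hf ->.
Qed.

Lemma supp_inD mon f g : supp_in mon f -> supp_in mon g -> supp_in mon (f + g).
Proof.
move=> /supp_inP hf /supp_inP hg; apply/supp_inP => m nm.
by rewrite mcoeffD hf // hg // addr0.
Qed.

Lemma supp_in_sum mon (I : Type) (r : seq I) (P : pred I) (F : I -> S) :
  (forall i, P i -> supp_in mon (F i)) -> supp_in mon (\sum_(i <- r | P i) F i).
Proof. by move=> hF; apply: big_ind => //; [apply: supp_in0|apply: supp_inD]. Qed.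

Lemma supp_inZX mon c m : mon m -> supp_in mon (c *: 'X_[m]).
Proof. by move=> hm m' /msuppZ_le; rewrite msuppX inE => /eqP->. Qed.

(** The exponents of the monomials of [X^v K[Z]]. *)
Definition in_box v Z m := [forall i, if i \in Z then v i <= m i else m i == v i]%N.

Lemma in_boxP v Z m :
  reflect ((forall i, i \in Z -> v i <= m i)%N /\ (forall i, i \notin Z -> m i = v i))
    (in_box v Z m).
Proof.
apply: (iffP forallP) => [h|[h1 h2] i]; last first.
  by case: ifPn => [/h1|/h2->].
by split=> i; have := h i; case: (i \in Z) => // /eqP.
Qed.

Lemma in_box_refl v Z : in_box v Z v.
Proof. by apply/in_boxP; split. Qed.

Lemma polys_inE Z : polys_in Z = supp_in (in_box 0%MM Z).
Proof.
apply/seteqP; split=> g hg k /hg; last first.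
  by move=> /in_boxP[_ h] i /h; rewrite mnm0E.
by move=> h; apply/in_boxP; split=> i iZ; rewrite mnm0E // h.
Qed.

Lemma zK_monomialE v Z : zK ('X_[v] : S) Z = supp_in (in_box v Z).
Proof.
apply/seteqP; split=> [f [g hg <-] m|f hf].
  rewrite mulrC (perm_mem (msuppMX _ _)) => /mapP[m' /hg hm' ->].
  by apply/in_boxP; split=> i iZ; rewrite mnmDE ?leq_addr // hm' ?addn0.
exists (\sum_(m <- msupp f) f@_m *: 'X_[(m - v)%MM]).
  rewrite polys_inE big_seq; apply: supp_in_sum => m /hf /in_boxP[_ hm].
  apply: supp_inZX; apply/in_boxP; split=> // i iZ; rewrite ?mnm0E //.
  by rewrite mnmBE hm // subnn.
rewrite mulr_sumr [RHS]mpolyE; apply: eq_big_seq => m /hf /in_boxP[h1 h2].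
rewrite -scalerAr -mpolyXD addmC submK //; apply/mnm_lepP => i.
by case: (boolP (i \in Z)) => [/h1|/h2 ->].
Qed.

Lemma sdepth_ge (M : set S) r (z : 'I_r -> S) (Z : 'I_r -> {set 'I_n}) b :
  stanley_decomposition M z Z -> (forall i, b <= #|Z i|)%N -> (b <= n)%N ->
  (b <= sdepth M)%N.
Proof.
move=> hD hb bn; pose k := sdepth_decomposition Z.
have bk : (b <= k)%N.
  by apply: (big_ind (fun k => b <= k)%N) => // x y; rewrite leq_min => -> ->.
have kn : (k < n.+1)%N.
  rewrite ltnS /k /sdepth_decomposition.
  elim/big_ind : _ => // [x y xn _|i _]; first by rewrite geq_min xn.
  by rewrite -[leqRHS]card_ord max_card.
apply: leq_trans bk _.
apply: (@leq_bigmax_cond _ _ (fun k : 'I_n.+1 => nat_of_ord k) (Ordinal kn)).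
by apply/asboolP; exists r, z, Z.
Qed.

(** A partition of the monomials of an ideal into boxes, given by the maps that
    send a monomial to the corner and to the free directions of its box, is a
    Stanley decomposition.  Bounding the degrees of the corners makes the family
    of boxes finite; it is indexed by the corners, which are their own image
    under the corner map. *)
Lemma sdepth_ge_box_partition mon (v : 'X_{1..n} -> 'X_{1..n})
    (Z : 'X_{1..n} -> {set 'I_n}) (D b : nat) :
  (forall m, mon m -> mdeg (v m) < D)%N ->
  (forall m, mon m -> in_box (v m) (Z m) m) ->
  (forall m m', mon m -> in_box (v m) (Z m) m' ->
     [/\ mon m', v m' = v m & Z m' = Z m]) ->
  (forall m, mon m -> b <= #|Z m|)%N -> (b <= n)%N ->
  (b <= sdepth (supp_in mon))%N.
Proof.
move=> vD box_self box_stable Zb bn.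
have vv m : mon m -> mon (v m) /\ v (v m) = v m.
  by move=> hm; have [] := box_stable _ _ hm (in_box_refl (v m) (Z m)).
pose J := [pred w : 'X_{1..n < D} | mon w && (v w == w)].
pose c (i : 'I_#|J|) : 'X_{1..n} := enum_val i.
have monc i : mon (c i) by have /andP[] := enum_valP i.
have vc i : v (c i) = c i by have /andP[_ /eqP] := enum_valP i.
have c_inj : injective c by move=> i j /val_inj /enum_val_inj.
have c_surj m : mon m -> exists i, c i = v m.
  move=> hm; have [monv vvm] := vv _ hm.
  have Jv : BMultinom (vD _ hm) \in J by rewrite inE /= monv vvm eqxx.
  by exists (enum_rank_in Jv (BMultinom (vD _ hm))); rewrite /c enum_rankK_in.
have box_c i m : in_box (c i) (Z (c i)) m -> mon m /\ v m = c i.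
  rewrite -{1}(vc i) => /box_stable[//|]; rewrite vc => ? ?; by split.
apply: (@sdepth_ge _ _ (fun i => 'X_[c i]) (fun i => Z (c i))) => // [|i]; last exact: Zb.
split=> [i||].
- split.
  + by move=> m; rewrite msuppX inE => /eqP->.
  + by exists 1, (c i); rewrite scale1r.
  + move=> f _ /eqP; rewrite mulf_eq0 => /orP[|/eqP//].
    by move/eqP/(congr1 (mcoeff (c i))); rewrite mcoeffX eqxx mcoeff0 => /eqP;
       rewrite oner_eq0.
- apply/seteqP; split=> [p hp|p [w hw ->]]; last first.
    apply: supp_in_sum => i _ m; have := hw i; rewrite zK_monomialE => h /h.
    by case/box_c.
  exists (fun i => \sum_(m <- msupp p | v m == c i) p@_m *: 'X_[m]) => [i|].
    rewrite zK_monomialE big_seq_cond; apply: supp_in_sum => m /andP[/hp hm /eqP vm].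
    apply: supp_inZX; rewrite -vm -(_ : Z m = Z (v m)) ?box_self //.
    by have [] := box_stable _ _ hm (in_box_refl (v m) (Z m)).
  rewrite (exchange_big_dep xpredT) //= [LHS]mpolyE; apply: eq_big_seq => m /hp hm.
  have [i ci] := c_surj _ hm.
  by rewrite (big_pred1 i) // => j; rewrite -ci (inj_eq c_inj) eq_sym.
- move=> w hw sum0 i; apply/mpolyP => m; rewrite mcoeff0.
  have hw' j : supp_in (in_box (c j) (Z (c j))) (w j) by rewrite -zK_monomialE.
  have /supp_inP hwi := hw' i.
  case: (boolP (in_box (c i) (Z (c i)) m)) => [bm|/hwi//].
  have := congr1 (mcoeff m) sum0; rewrite mcoeff0 raddf_sum (bigD1 i) //= big1 ?addr0 //.
  move=> j ji; have /supp_inP hwj := hw' j; apply: hwj.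
  apply: contra_neqN ji => /box_c[_ vj]; apply: c_inj; rewrite -vj.
  by have [] := box_c _ _ bm.
Qed.
End SupportSpaces.

(** * Stanley depth of an intersection of two irreducible ideals *)

Section IntersectionPartition.
Variables (K : fieldType) (n : nat).
Local Notation S := {mpoly K[n]}.
Implicit Types (A B : {set 'I_n}) (a b c : 'I_n -> nat) (m : 'X_{1..n}).

(** The monomials of the ideal generated by the [X_i ^+ a i], [i] in [A]. *)
Definition some_ge A a m := [exists i in A, a i <= m i]%N.

Definition ge_set c m : {set 'I_n} := [set i | c i <= m i]%N%SET.

Lemma in_ge_set c m i : (i \in ge_set c m) = (c i <= m i)%N.
Proof. by rewrite inE. Qed.

(* One of the two ideals, (X_i ^ a_i : i in A), is treated here; B indexes the
   variables of the other one.  The exponents at A :&: B are kept by the box of a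
   monomial as far as they matter.  Either they put the monomial in the ideal, and
   then those at A :\: B are free, or the set of the i in A :\: B with c i <= m i
   is not empty and the interval of that set is used. *)
Section OneIdeal.
Variables (A B : {set 'I_n}) (a c : 'I_n -> nat).
Hypothesis c_own : forall i, i \in A :\: B -> c i = a i.

Definition own_bot m :=
  if some_ge (A :&: B) a m then finset.set0
  else interval_bot (A :\: B) ((A :\: B) :&: ge_set c m).
Definition own_top m :=
  if some_ge (A :&: B) a m then A :\: B
  else interval_top (A :\: B) ((A :\: B) :&: ge_set c m).

Lemma own_ge_neq0 m : some_ge A a m -> ~~ some_ge (A :&: B) a m ->
  (A :\: B) :&: ge_set c m != finset.set0.
Proof.
case/exists_inP => i iA aim /exists_inPn nC; apply/set0Pn; exists i.
have iB : i \notin B by apply/negP => iB; have := nC i; rewrite inE iA iB aim => /(_ isT).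
by rewrite !inE iB iA c_own ?aim // inE iB iA.
Qed.

Lemma own_bot_sub m : own_bot m \subset (A :\: B) :&: ge_set c m.
Proof.
by rewrite /own_bot; case: ifP => _; rewrite ?sub0set // interval_bot_sub // subsetIl.
Qed.

Lemma own_top_sup m : (A :\: B) :&: ge_set c m \subset own_top m.
Proof.
by rewrite /own_top; case: ifP => _; rewrite ?subsetIl // interval_top_sup // subsetIl.
Qed.

Lemma own_top_sub m : own_top m \subset A :\: B.
Proof. by rewrite /own_top; case: ifP => _ //; apply: interval_top_sub. Qed.

Lemma card_own_top m : some_ge A a m -> (uphalf #|A :\: B| <= #|own_top m|)%N.
Proof.
move=> hm; rewrite /own_top; case: ifPn => [_|nC].
  by rewrite leq_uphalf_double -addnn leq_addr.
by apply: card_interval_top; rewrite ?subsetIl ?own_ge_neq0.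
Qed.

(** If [m'] has the constraints imposed by the box of [m], then the two monomials
    belong to the ideal for the same reason and they define the same box. *)
Lemma own_interval_stable m m' : some_ge A a m ->
  (forall i, i \in A :&: B -> (a i <= m' i) = (a i <= m i))%N ->
  (forall i, i \in own_bot m -> c i <= m' i)%N ->
  (forall i, i \in (A :\: B) :\: own_top m -> m' i = m i) ->
  [/\ some_ge A a m', own_bot m' = own_bot m & own_top m' = own_top m].
Proof.
move=> hm eqC ge_bot eq_top.
have eq_shared : some_ge (A :&: B) a m' = some_ge (A :&: B) a m.
  by apply: eq_existsb => i; case iC: (i \in A :&: B) => //=; rewrite eqC.
case: (boolP (some_ge (A :&: B) a m)) => [sh|nsh].
  rewrite /own_bot /own_top eq_shared sh; split=> //.
  have /exists_inP[i] : some_ge (A :&: B) a m' by rewrite eq_shared.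
  by rewrite inE => /andP[iA _] ai; apply/exists_inP; exists i.
have subP : (A :\: B) :&: ge_set c m \subset A :\: B by apply: subsetIl.
have T0 := own_ge_neq0 hm nsh.
have botE : own_bot m = interval_bot (A :\: B) ((A :\: B) :&: ge_set c m).
  by rewrite /own_bot (negbTE nsh).
have topE : own_top m = interval_top (A :\: B) ((A :\: B) :&: ge_set c m).
  by rewrite /own_top (negbTE nsh).
have bot' : own_bot m \subset (A :\: B) :&: ge_set c m'.
  apply/subsetP => i ib; have := subsetP (own_bot_sub m) i ib.
  by rewrite !in_setI => /andP[-> _]; rewrite in_ge_set ge_bot.
have top' : (A :\: B) :&: ge_set c m' \subset own_top m.
  apply/subsetP => i; rewrite in_setI in_ge_set => /andP[iP cim'].
  apply: contraTT cim' => it; rewrite eq_top; last by rewrite in_setD it.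
  apply: contra it => cim; apply: (subsetP (own_top_sup m)).
  by rewrite in_setI iP in_ge_set.
rewrite botE in bot'; rewrite topE in top'.
have [eb et] := interval_stable subP T0 bot' top'.
rewrite /own_bot /own_top eq_shared (negbTE nsh) eb et; split=> //.
have /set0Pn[i] := interval_neq0 subP T0 bot' top'.
rewrite in_setI in_ge_set => /andP[iP]; rewrite c_own // => ai.
by apply/exists_inP; exists i => //; move: iP; rewrite inE => /andP[].
Qed.
End OneIdeal.

Section TwoIdeals.
Variables (A B : {set 'I_n}) (a b : 'I_n -> nat).

(* Above the maximum of the two exponents, a shared variable has no more influence
   on the membership in either ideal. *)
Let c i := if i \in A then (if i \in B then maxn (a i) (b i) else a i) else b i.

Let shared m := (A :&: B) :&: ge_set c m.

(** At the shared variables each exponent is a value of its own, except that the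
    exponents from [c i] on form a single ray. *)
Definition box_bot m := own_bot A B a c m :|: own_bot B A b c m :|: shared m.
Definition box_top m :=
  own_top A B a c m :|: own_top B A b c m :|: shared m :|: ~: (A :|: B).
Definition box_corner m := [multinom
  (if i \in box_bot m then c i else if i \in box_top m then 0%N else m i) | i < n].

(** The free directions of a box contain the variables of neither ideal and, for
    each ideal, at least half of the variables which it does not share. *)
Lemma sdepth_some_ge_capI :
  (n - #|A :|: B| + uphalf #|A :\: B| + uphalf #|B :\: A|
     <= sdepth (@supp_in K n [pred m | some_ge A a m && some_ge B b m]))%N.
Proof.
have cA i : i \in A :\: B -> c i = a i.
  by rewrite in_setD /c => /andP[/negbTE nX iY]; rewrite ?nX ?iY.
have cB i : i \in B :\: A -> c i = b i.
  by rewrite in_setD /c => /andP[/negbTE nX iY]; rewrite ?nX ?iY.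
have ge_bot i m : i \in box_bot m -> (c i <= m i)%N.
  rewrite !in_setU => /orP[/orP[]|].
  - by move=> /(subsetP (own_bot_sub _ _ _ _ _)); rewrite in_setI in_ge_set => /andP[].
  - by move=> /(subsetP (own_bot_sub _ _ _ _ _)); rewrite in_setI in_ge_set => /andP[].
  - by rewrite in_setI in_ge_set => /andP[].
have bot_top m : box_bot m \subset box_top m.
  rewrite subsetU // !setUSS // ?subxx //.
    exact: subset_trans (own_bot_sub _ _ _ _ _) (own_top_sup _ _ _ _ _).
  exact: subset_trans (own_bot_sub _ _ _ _ _) (own_top_sup _ _ _ _ _).
have lt_top i m : i \notin box_top m -> (m i < c i)%N.
  rewrite ltnNge; apply: contraNN => cim; rewrite !in_setU in_setC in_setU.
  case: (boolP (i \in A)) => iA; case: (boolP (i \in B)) => iB //=; rewrite ?orbT //.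
  - by rewrite /shared !in_setI in_ge_set iA iB cim !orbT.
  - rewrite (_ : i \in own_top A B a c m) //; apply: (subsetP (own_top_sup _ _ _ _ _)).
    by rewrite in_setI in_setD in_ge_set iA iB.
  - rewrite (_ : i \in own_top B A b c m) ?orbT //; apply: (subsetP (own_top_sup _ _ _ _ _)).
    by rewrite in_setI in_setD in_ge_set iA iB.
have cornerE i m : box_corner m i =
    if i \in box_bot m then c i else if i \in box_top m then 0%N else m i.
  by rewrite mnmE.
apply: (@sdepth_ge_box_partition _ _ _ box_corner box_top (\sum_i c i).+1).
- move=> m _; rewrite ltnS mdegE; apply: leq_sum => i _.
  by rewrite cornerE; case: ifP => // _; case: ifPn => // /lt_top/ltnW.
- move=> m _; apply/in_boxP; split=> i itop; rewrite cornerE.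
    by case: ifP => [/ge_bot|] //; rewrite itop.
  by rewrite (negbTE itop) ifN //; apply: contra itop; apply: (subsetP (bot_top m)).
- move=> m m' /andP[hA hB] /in_boxP[box1 box2].
  have off i : i \notin box_top m -> m' i = m i.
    move=> itop; rewrite box2 // cornerE (negbTE itop) ifN //.
    by apply: contra itop; apply: (subsetP (bot_top m)).
  have ge_bot' i : i \in box_bot m -> (c i <= m' i)%N.
    move=> ib; have it := subsetP (bot_top m) _ ib.
    by have := box1 _ it; rewrite cornerE ib.
  have sharedP i : i \in A :&: B -> m' i = m i \/ (c i <= m i /\ c i <= m' i)%N.
    move=> iC; case: (boolP (i \in shared m)) => ish.
      right; split; last by apply: ge_bot'; rewrite !in_setU ish !orbT.
      by move: ish; rewrite in_setI in_ge_set => /andP[].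
    left; apply: off; rewrite !in_setU (negbTE ish) in_setC in_setU.
    move: iC; rewrite in_setI => /andP[iA iB]; rewrite iA /= !orbF.
    apply/norP; split; apply/negP => /(subsetP (own_top_sub _ _ _ _ _));
      by rewrite in_setD ?iA ?iB.
  have eq_shared : shared m' = shared m.
    apply/setP => i; rewrite !in_setI !inE -in_setI; case iC: (i \in A :&: B) => //=.
    by have [->|[-> ->]] := sharedP i iC.
  have [|||hA' botA topA] := @own_interval_stable A B a c cA m m' hA.
  + move=> i iC; have [->//|[h h']] := sharedP i iC.
    have ac : (a i <= c i)%N.
      by rewrite /c; move: iC; rewrite in_setI => /andP[-> ->]; rewrite leq_maxl.
    by rewrite !(leq_trans ac).
  + by move=> i ib; apply: ge_bot'; rewrite !in_setU ib.
  + move=> i; rewrite !in_setD => /and3P[it iB iA]; apply: off.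
    rewrite !in_setU in_setC in_setU iA (negbTE it) /shared !in_setI (negbTE iB) andbF /= !orbF.
    by apply/negP => /(subsetP (own_top_sub _ _ _ _ _)); rewrite in_setD iA.
  have [|||hB' botB topB] := @own_interval_stable B A b c cB m m' hB.
  + move=> i; rewrite setIC => iC; have [->//|[h h']] := sharedP i iC.
    have bc : (b i <= c i)%N.
      by rewrite /c; move: iC; rewrite in_setI => /andP[-> ->]; rewrite leq_maxr.
    by rewrite !(leq_trans bc).
  + by move=> i ib; apply: ge_bot'; rewrite !in_setU ib orbT.
  + move=> i; rewrite !in_setD => /and3P[it iA iB]; apply: off.
    rewrite !in_setU in_setC in_setU iB (negbTE it) /shared !in_setI (negbTE iA) /= !orbF.
    by apply/negP => /(subsetP (own_top_sub _ _ _ _ _)); rewrite in_setD iB.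
  have eq_bot : box_bot m' = box_bot m by rewrite /box_bot botA botB eq_shared.
  have eq_top : box_top m' = box_top m by rewrite /box_top topA topB eq_shared.
  split=> //=; first by rewrite hA' hB'.
  apply/mnmP => i; rewrite !cornerE eq_bot eq_top.
  by case: ifP => // _; case: ifPn => // /off.
- move=> m /andP[hA hB].
  have /card_own_top := hA => /(_ B c cA) tA.
  have /card_own_top := hB => /(_ A c cB) tB.
  have dis1 : #|own_top A B a c m :|: own_top B A b c m| =
     (#|own_top A B a c m| + #|own_top B A b c m|)%N.
    apply/eqP; rewrite (leq_card_setU _ _); apply: disjointWl (own_top_sub _ _ _ _ _) _.
    apply: disjointWr (own_top_sub _ _ _ _ _) _.
    by rewrite -setI_eq0; apply/eqP/setP => i; rewrite !inE; case: (i \in A); rewrite ?andbF.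
  have dis2 : #|own_top A B a c m :|: own_top B A b c m :|: ~: (A :|: B)| =
     (#|own_top A B a c m :|: own_top B A b c m| + #|~: (A :|: B)|)%N.
    apply/eqP; rewrite (leq_card_setU _ _) disjoints_subset setCK.
    by rewrite subUset !(subset_trans (own_top_sub _ _ _ _ _)) // subDset setUA
       ?subsetUr // setUAC subsetUr.
  apply: (@leq_trans #|own_top A B a c m :|: own_top B A b c m :|: ~: (A :|: B)|).
    by rewrite dis2 dis1; have := cardsC (A :|: B); rewrite card_ord; lia.
  by apply: subset_leq_card; rewrite setSU // subsetUl.
- have := cardsC (A :|: B); rewrite card_ord.
  have := cardsUI A B; have := cardsID B A; have := cardsID A B; rewrite setIC.
  lia.
Qed.
End TwoIdeals.
End IntersectionPartition.

(** * Ideals, prime ideals and quotients *)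

Section IdealsAndQuotients.
Variable R : comNzRingType.
Implicit Types (I P G : set R).

Lemma idealr_closedP P :
  idealr_closed (mem P) <-> is_ideal P /\ ~ P 1.
Proof.
rewrite /idealr_closed /in_mem /=; split=> [[/asboolP P0 /asboolP P1 PD]|[[P0 PD] P1]].
  by split=> //; split=> // a u v /asboolP Pu /asboolP Pv; apply/asboolP/PD.
split=> [||a u v /asboolP Pu /asboolP Pv]; [exact/asboolP|exact/asboolP|exact/asboolP/PD].
Qed.

Lemma is_primeP P :
  is_prime P <-> [/\ is_ideal P, ~ P 1 & forall u v, P (u * v) -> P u \/ P v].
Proof.
rewrite /is_prime idealr_closedP /prime_idealr_closed /in_mem /=.
split=> [[[idP P1] prP]|[idP P1 prP]].
  by split=> // u v /asboolP /prP /orP[] /asboolP; [left|right].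
split=> // u v /asboolP /prP[] /asboolP h; apply/orP; [left|right]; exact: h.
Qed.

Lemma is_ideal_gen G : is_ideal (ideal_gen G).
Proof.
split=> [I [[] //]|a u v Gu Gv I idGI].
by have [[_ ID] _] := idGI; apply: ID; [apply: Gu|apply: Gv].
Qed.

Lemma ideal_gen_min G I : is_ideal I -> G `<=` I -> ideal_gen G `<=` I.
Proof. exact: smallest_sub. Qed.

Lemma idealD I u v : is_ideal I -> I u -> I v -> I (u + v).
Proof. by move=> [_ ID] Iu Iv; rewrite -[u]mul1r; apply: ID. Qed.

Lemma idealM I a u : is_ideal I -> I u -> I (a * u).
Proof. by move=> [I0 ID] Iu; rewrite -[_ * _]addr0; apply: ID. Qed.

Lemma ideal_sum I (J : Type) (r : seq J) (p : pred J) (F : J -> R) :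
  is_ideal I -> (forall j, p j -> I (F j)) -> I (\sum_(j <- r | p j) F j).
Proof. by move=> idI; apply: big_ind => [|u v]; [case: idI|apply: idealD]. Qed.

Lemma is_ideal_add I P : is_ideal I -> is_ideal P -> is_ideal (ideal_add I P).
Proof.
move=> [I0 ID] [P0 PD]; split; first by exists 0 => //; exists 0 => //; rewrite addr0.
move=> a _ _ [u Iu [v Pv <-]] [u' Iu' [v' Pv' <-]].
exists (a * u + u'); first exact: ID.
by exists (a * v + v'); [apply: PD|rewrite mulrDr addrACA].
Qed.

Lemma prime_exp P u k : is_prime P -> P (u ^+ k) -> P u.
Proof.
move=> /is_primeP[_ P1 prP]; elim: k => [/P1//|k IHk].
by rewrite exprS => /prP[|/IHk].
Qed.

Lemma prime_chain_le e (C : nat -> set R) i j :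
  prime_chain e C -> (i <= j)%N -> (j <= e)%N -> C i `<=` C j.
Proof.
move=> [_ ltC]; elim: j => [|j IHj]; first by rewrite leqn0 => /eqP-> _ x.
rewrite leq_eqVlt => /orP[/eqP-> _ x //|ij je].
by move=> x /(IHj ij (ltnW je)); have [sub _] := ltC _ je; apply: sub.
Qed.

Lemma krull_dimE d : is_krull_dim R d -> krull_dim R = d.
Proof.
move=> hd; rewrite /krull_dim; apply: xget_unique => //= d' [[C' C'd'] max'].
case: hd => [[C Cd] maxd].
by apply/eqP; rewrite eqn_leq (max' _ _ Cd) (maxd _ _ C'd').
Qed.

(** The only facts about the quotient ring which the dimension depends on. *)
Lemma quot_ring_proj I (hI : idealr_closed (mem I)) :
  exists p : {rmorphism R -> quot_ring hI},
    (forall y, exists x, p x = y) /\ (forall x, p x = 0 <-> I x).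
Proof.
exists (\pi_(quot_ring hI))%qT; split=> [y|x]; first by exists (repr y); apply: reprK.
have := Quotient.idealrBE (ideal_pred hI : idealr R) x 0.
rewrite subr0 => h; split=> [x0|Ix].
  apply/asboolP; suff : x \in (ideal_pred hI : idealr R) by [].
  by rewrite h; apply/eqP; rewrite x0 rmorph0.
by apply/eqP; rewrite -(rmorph0 (\pi_(quot_ring hI))%qT) -h; apply/asboolP.
Qed.

End IdealsAndQuotients.

Section PrimesUnderSurjection.
Variables (R Q : comNzRingType) (p : {rmorphism R -> Q}).
Hypothesis p_surj : forall y, exists x, p x = y.

Lemma preimage_prime (P : set Q) : is_prime P -> is_prime (p @^-1` P).
Proof.
move=> /is_primeP[[P0 PD] P1 prP]; apply/is_primeP; split.
- by split=> [|a u v Pu Pv] /=; rewrite ?rmorph0 // rmorphD rmorphM; apply: PD.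
- by rewrite /= rmorph1.
- by move=> u v /=; rewrite rmorphM; apply: prP.
Qed.

Lemma image_primeE (P : set R) x : is_ideal P -> (forall u, p u = 0 -> P u) ->
  (p @` P) (p x) <-> P x.
Proof.
move=> idP kerP; split=> [[u Pu pu]|Px]; last by exists x.
rewrite -[x](subrK u) addrC; apply: idealD => //; apply: kerP.
by rewrite rmorphB pu subrr.
Qed.

Lemma image_prime (P : set R) : (forall u, p u = 0 -> P u) ->
  is_prime P -> is_prime (p @` P).
Proof.
move=> kerP /is_primeP[idP P1 prP]; have imE := image_primeE _ idP kerP.
apply/is_primeP; split.
- split=> [|a _ _ [u Pu <-] [v Pv <-]]; first by exists 0; [case: idP|rewrite rmorph0].
  have [b <-] := p_surj a; exists (b * u + v); last by rewrite rmorphD rmorphM.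
  by case: idP => _; apply.
- by rewrite -(rmorph1 p) => /imE.
- move=> a b; have [u <-] := p_surj a; have [v <-] := p_surj b.
  by rewrite -rmorphM => /imE /prP[] h; [left|right]; apply/imE.
Qed.

End PrimesUnderSurjection.

(** Chains of primes of [R / I] are chains of primes of [R] above [I]. *)
Lemma quot_dim_eq (R : comNzRingType) (I : set R) (d : nat) : is_ideal I ->
  (exists2 C, prime_chain d C & I `<=` C 0%N) ->
  (forall e C, prime_chain e C -> I `<=` C 0%N -> (e <= d)%N) ->
  quot_dim I = d.
Proof.
move=> idI [C [prC ltC] IC0] maxC; rewrite /quot_dim.
case: pselect => [hI|]; last first.
  case; apply/idealr_closedP; split=> // /IC0.
  by have /is_primeP[] := prC 0%N (leq0n _).
have [p [p_surj kerp]] := quot_ring_proj hI.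
apply: krull_dimE; split=> [|e D [prD ltD]].
  have IC i : (i <= d)%N -> forall u, p u = 0 -> C i u.
    by move=> id u /kerp /IC0; apply: (prime_chain_le (conj prC ltC)).
  exists (fun i => p @` C i); split=> i id; first exact: image_prime (IC i id) (prC i id).
  have [sub nsub] := ltC i id.
  split; first exact: image_subset.
  move=> im_sub; apply: nsub => x Cx.
  have /is_primeP[idC _ _] := prC i (ltnW id).
  by apply/(image_primeE _ idC (IC _ (ltnW id))); apply: im_sub; exists x.
apply: (maxC e (fun i => p @^-1` D i)).
  split=> i ie; first exact: preimage_prime (prD i ie).
  have [sub nsub] := ltD i ie; split; first by move=> x; apply: sub.
  by move=> pre_sub; apply: nsub => y; have [x <-] := p_surj y; apply: pre_sub.
by move=> x /kerp px /=; rewrite px; have /is_primeP[[]] := prD 0%N (leq0n _).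
Qed.

(** * Dimension of the quotient by an irreducible monomial ideal *)

Section MonomialQuotientDimension.
Variables (K : fieldType) (n : nat).
Local Notation S := {mpoly K[n]}.
Implicit Types (A B : {set 'I_n}) (a : 'I_n -> nat) (f g : S) (I P : set S).

(** A polynomial is the sum of its terms, and each of them is a multiple of one of
    the generators when the exponents allow it. *)
Lemma ideal_gen_powersE A a :
  ideal_gen [set f : S | exists2 i, i \in A & f = 'X_i ^+ a i] = supp_in (some_ge A a).
Proof.
apply/seteqP; split=> [|f hf].
  apply: ideal_gen_min => [|_ [i iA ->] m]; last first.
    rewrite mpolyXn msuppX inE => /eqP->; apply/exists_inP; exists i => //.
    by rewrite mulmnE mnm1E eqxx mul1n.
  split=> [|p f g hf hg]; first exact: supp_in0.
  apply: supp_inD => // m /msuppM_le /allpairsP[[m1 m2] /= [_ /hf/exists_inP[i iA ai] ->]].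
  by apply/exists_inP; exists i => //; rewrite mnmDE (leq_trans ai) ?leq_addl.
rewrite [f]mpolyE big_seq; apply: ideal_sum (is_ideal_gen _) _ => m /hf.
case/exists_inP => i iA ai; rewrite -mul_mpolyC; apply: (idealM _ (is_ideal_gen _)).
have -> : m = (m - U_(i) *+ a i + U_(i) *+ a i)%MM.
  rewrite submK //; apply/mnm_lepP => j; rewrite mulmnE mnm1E.
  by case: eqP => [<-|]; rewrite ?mul1n.
rewrite mpolyXD -mpolyXn; apply: (idealM _ (is_ideal_gen _)).
by apply: sub_gen_smallest; exists i.
Qed.

(** The ideal generated by the [X_i], [i] in [A] (see [coord_idealE]), given by
    its monomials to make membership explicit. *)
Definition coord_ideal A : set S := supp_in (some_ge A (fun=> 1%N)).

Lemma coord_idealE A :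
  coord_ideal A = ideal_gen [set f : S | exists2 i, i \in A & f = 'X_i ^+ 1].
Proof. by rewrite ideal_gen_powersE. Qed.

Lemma coord_ideal_min A P :
  is_ideal P -> (forall i, i \in A -> P 'X_i) -> coord_ideal A `<=` P.
Proof.
move=> idP XP; rewrite coord_idealE.
by apply: ideal_gen_min => // _ [i /XP ? ->].
Qed.

Lemma ideal_gen_powers_sub A a : (forall i, i \in A -> (0 < a i)%N) ->
  ideal_gen [set f : S | exists2 i, i \in A & f = 'X_i ^+ a i] `<=` coord_ideal A.
Proof.
move=> a_gt0; rewrite ideal_gen_powersE => f hf m /hf /exists_inP[i iA ai].
by apply/exists_inP; exists i; rewrite // (leq_trans (a_gt0 _ iA)).
Qed.

Lemma coord_ideal_is_ideal A : is_ideal (coord_ideal A).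
Proof. by rewrite coord_idealE; apply: is_ideal_gen. Qed.

Lemma mem_coord_ideal A i : coord_ideal A 'X_i <-> i \in A.
Proof.
split=> [h|iA]; last by rewrite coord_idealE; apply: sub_gen_smallest; exists i.
have /exists_inP[j jA] : some_ge A (fun=> 1%N) U_(i)%MM by apply: h; rewrite msuppX inE.
by rewrite mnm1E; case: eqP => [->|].
Qed.

Lemma coord_ideal_mono A B : A \subset B -> coord_ideal A `<=` coord_ideal B.
Proof.
move=> AB; apply: coord_ideal_min (coord_ideal_is_ideal B) _ => i iA.
by apply/mem_coord_ideal/(subsetP AB).
Qed.

(** As the kernel of an endomorphism of a domain, the ideal is prime. *)
Lemma coord_ideal_kernel A f :
  coord_ideal A f <-> f \mPo [tuple if i \in A then 0 else 'X_i | i < n] = 0.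
Proof.
set s := [tuple _ | _ < n].
have sX m : 'X_[m] \mPo s = if some_ge A (fun=> 1%N) m then 0 else 'X_[m] :> S.
  rewrite comp_mpolyX; case: ifPn => [/exists_inP[i iA mi]|/exists_inPn nA].
    by rewrite (bigD1 i) //= tnth_mktuple iA; case: (m i) mi => // k _; rewrite exprS !mul0r.
  rewrite [RHS]mpolyXE_id; apply: eq_bigr => i _; rewrite tnth_mktuple.
  case: ifP => // /nA; rewrite -leqNgt leqn0 => /eqP->; by rewrite !expr0.
have sE m : ~~ some_ge A (fun=> 1%N) m -> (f \mPo s)@_m = f@_m.
  move=> nm; rewrite comp_mpolyEX raddf_sum /= [in RHS](mpolyE f) raddf_sum /=.
  apply: eq_bigr => k _; rewrite !mcoeffZ sX; case: ifP => // hk.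
  rewrite mcoeff0 mcoeffX; case: eqP => // km; by rewrite -km hk in nm.
split=> [hf|f0]; last by apply/supp_inP => m nm; rewrite -sE // f0 mcoeff0.
rewrite comp_mpolyEX big_seq big1 // => m /hf hm; by rewrite sX hm scaler0.
Qed.

Lemma coord_ideal_prime A : is_prime (coord_ideal A).
Proof.
apply/is_primeP; split; first exact: coord_ideal_is_ideal.
  by rewrite coord_ideal_kernel rmorph1 => /eqP; rewrite oner_eq0.
move=> u v; rewrite !coord_ideal_kernel rmorphM => /eqP.
by rewrite mulf_eq0 => /orP[] /eqP; [left|right].
Qed.

(** The variables outside [A] are added one at a time. *)
Lemma coord_chain A :
  exists2 C, prime_chain (n - #|A|)%N C & C 0%N = coord_ideal A.
Proof.
pose V (k : nat) := A :|: [set i in take k (enum (~: A))].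
exists (fun k => coord_ideal (V k)); last first.
  by congr coord_ideal; apply/setP => i; rewrite !inE take0 in_nil orbF.
split=> k kn; first exact: coord_ideal_prime.
have szA : size (enum (~: A)) = (n - #|A|)%N.
  by rewrite -cardE; have := cardsC A; rewrite card_ord; lia.
rewrite -szA in kn.
split.
  apply: coord_ideal_mono; apply: setUS; apply/subsetP => i; rewrite !inE.
  by rewrite (take_nth i) // mem_rcons inE => ->; rewrite orbT.
have [i0 _] : exists i : 'I_n, True by case: (enum _) kn => // i; exists i.
pose i := nth i0 (enum (~: A)) k.
have iV : i \in V k.+1 by rewrite !inE (take_nth i0) // mem_rcons mem_head orbT.
move=> /(_ 'X_i (proj2 (mem_coord_ideal _ _) iV)) /mem_coord_ideal.
have : i \in ~: A by rewrite -mem_enum mem_nth.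
rewrite !inE => /negbTE -> /=.
have := enum_uniq (~: A); rewrite -{1}(cat_take_drop k (enum (~: A))) cat_uniq.
by rewrite (drop_nth i0) //= => /and3P[_ /norP[/negbTE->]].
Qed.

Definition indep_mod P (J : finType) (b : J -> S) :=
  forall c : J -> K, P (\sum_j c j *: b j) -> forall j, c j = 0.

(** In a relation between the [x ^+ s * b j] modulo [P0], the terms with [s = 0]
    form a relation between the [b j] modulo [P1], as [x] is in [P1]; it is
    trivial, and the remaining terms can be divided by [x] since [P0] is prime
    and does not contain [x]. *)
Lemma indep_mod_powers P0 P1 x N (J : finType) (b : J -> S) :
  is_prime P0 -> is_prime P1 -> P0 `<=` P1 -> P1 x -> ~ P0 x ->
  indep_mod P1 b -> indep_mod P0 (fun p : 'I_N * J => x ^+ p.1 * b p.2).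
Proof.
move=> /is_primeP[id0 _ pr0] /is_primeP[id1 _ _] P01 P1x P0x indep.
have key M (c : nat -> J -> K) : P0 (\sum_(s < M) x ^+ s * \sum_j c s j *: b j) ->
    forall s j, (s < M)%N -> c s j = 0.
  elim: M c => // M IHM c; rewrite big_ord_recl expr0 mul1r.
  have -> : \sum_(s < M) x ^+ lift ord0 s * \sum_j c (lift ord0 s) j *: b j
      = x * \sum_(s < M) x ^+ s * \sum_j c s.+1 j *: b j.
    by rewrite mulr_sumr; apply: eq_bigr => s _; rewrite lift0 exprS mulrA.
  move=> sum0.
  have c0 : forall j, c 0%N j = 0.
    apply: indep; set v := (X in P1 X).
    rewrite -[v](addrK (x * \sum_(s < M) x ^+ s * \sum_j c s.+1 j *: b j)).
    apply: idealD => //; first exact: P01.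
    by rewrite mulrC -mulNr; apply: idealM.
  move: sum0; rewrite big1 ?add0r => [/pr0[/P0x//|/(IHM (fun s => c s.+1)){}IHM]|j _]; last first.
    by rewrite c0 scale0r.
  by case=> [|s] j sM; [apply: c0|apply: IHM].
move=> c sum0 [s j].
(* The index s is made a natural number to apply the claim above. *)
pose c' s' j' := if insub s' is Some s'' then c (s'', j') else 0.
have := key N c' _ s j (ltn_ord s); rewrite /c' valK; apply.
rewrite (eq_bigr (fun s' : 'I_N => \sum_j' c (s', j') *: (x ^+ s' * b j'))); last first.
  move=> s' _; rewrite mulr_sumr; apply: eq_bigr => j' _.
  by rewrite /c' valK scalerAr.
by rewrite pair_bigA /=; move: sum0; congr P0; apply: eq_bigr => -[].
Qed.

Definition deg_le (d : nat) : set S := supp_in (fun m => (mdeg m <= d)%N).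

Lemma deg_leM d e f g : deg_le d f -> deg_le e g -> deg_le (d + e) (f * g).
Proof.
move=> df eg m /msuppM_le /allpairsP[[m1 m2] /= [/df m1d /eg m2e ->]].
by rewrite mdegD leq_add.
Qed.

Lemma deg_le1 : deg_le 0 1.
Proof. by move=> m; rewrite msupp1 inE => /eqP->; rewrite mdeg0. Qed.

Lemma deg_leX d f k : deg_le d f -> deg_le (d * k) (f ^+ k).
Proof.
move=> df; elim: k => [|k IHk]; first by rewrite muln0 expr0; apply: deg_le1.
by rewrite exprS mulnS; apply: deg_leM.
Qed.

Lemma deg_le_mono d e f : (d <= e)%N -> deg_le d f -> deg_le e f.
Proof. by move=> de df m /df md; apply: leq_trans de. Qed.

Lemma deg_le_msize f : deg_le (msize f) f.
Proof. by move=> m /msize_mdeg_lt /ltnW. Qed.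

(** For [x_i] in [C i.+1] but not in [C i], the products of powers of the [x_i],
    [i < k], with exponents less than [N] are independent modulo [C 0].  This is
    the algebraic independence of the [x_i] in a quantitative form. *)
Lemma prime_chain_indep k C : prime_chain k C ->
  exists D, forall N, exists (J : finType) (b : J -> S),
    [/\ #|J| = (N ^ k)%N, forall j, deg_le (D * N) (b j) & indep_mod (C 0%N) b].
Proof.
elim: k C => [|k IHk] C chC.
  have /is_primeP[idC C1 _] := proj1 chC 0%N (leqnn _).
  exists 0%N => N; exists unit, (fun=> 1); split=> [|j|c]; first by rewrite card_unit.
    exact: deg_le1.
  rewrite (big_pred1 tt) => [Pc [] //|[]//].
  apply/eqP; apply: contra_notT C1 => c0.
  have -> : 1 = ((c tt)^-1)%:MP * (c tt *: 1) :> S.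
    by rewrite mul_mpolyC scalerA mulVf ?scale1r.
  exact: idealM.
have [|D hD] := IHk (fun i => C i.+1).
  by case: chC => prC ltC; split=> i ik; [apply: prC|apply: ltC].
have [sub /existsNP[x /not_implyP[C1x C0x]]] := proj2 chC 0%N isT.
exists (msize x + D)%N => N; have [J [b [cardJ degb indep]]] := hD N.
exists ('I_N * J)%type, (fun p : 'I_N * J => x ^+ p.1 * b p.2); split.
- by rewrite card_prod card_ord cardJ expnS.
- move=> [s j]; rewrite mulnDl; apply: deg_leM (degb j).
  have sN : (msize x * s <= msize x * N)%N by rewrite leq_mul2l ltnW ?orbT.
  exact: deg_le_mono sN (deg_leX (deg_le_msize (f := x))).
- apply: (@indep_mod_powers (C 0%N) (C 1%N)) => //; exact: (proj1 chC).
Qed.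

(** Modulo [P] only the coefficients at monomials without variables from [A] count.
    In degree at most [d] there are no more of them than exponents bounded by [d],
    and a family which outnumbers them has a relation. *)
Lemma card_indep_mod A P (J : finType) (b : J -> S) d : is_ideal P ->
  (forall i, i \in A -> P 'X_i) -> indep_mod P b -> (forall j, deg_le d (b j)) ->
  (#|J| <= d.+1 ^ (n - #|A|))%N.
Proof.
move=> idP XP indep degb.
pose E := {ffun {i : 'I_n | i \notin A} -> 'I_d.+1}.
pose mono (e : E) := [multinom (if insub i is Some k then nat_of_ord (e k) else 0%N) | i < n].
have <- : #|{: E}| = (d.+1 ^ (n - #|A|))%N.
  rewrite card_ffun card_ord card_sig; congr (_ ^ _)%N.
  have := cardsC A; rewrite card_ord -[#|[pred _ | _]|](eq_card (A := ~: A)).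
    by lia.
  by move=> i; rewrite inE.
rewrite leqNgt; apply/negP => ltEJ.
pose X : 'M[K]_(#|J|, #|{: E}|) := \matrix_(j, e) (b (enum_val j))@_(mono (enum_val e)).
have /rowV0Pn[v /sub_kermxP vX v0] : kermx X != 0.
  rewrite kermx_eq0 /row_free; apply/negP => /eqP rX.
  by have := rank_leq_col X; rewrite rX leqNgt ltEJ.
have cE (j : J) : v 0 (enum_rank j) = 0.
  apply: (indep (fun j => v 0 (enum_rank j))); apply: (coord_ideal_min idP XP).
  apply/supp_inP => m /exists_inPn nA.
  case: (boolP [forall i, m i <= d]%N) => [/forallP md|/forallPn[i]]; last first.
    rewrite -ltnNge => dm; rewrite raddf_sum big1 // => j' _.
    rewrite /= mcoeffZ (_ : _@_m = 0) ?mulr0 //.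
    have /supp_inP -> // := degb j'; rewrite -ltnNge (leq_trans dm) // mdegE.
    by rewrite (bigD1 i) //= leq_addr.
  pose e : E := [ffun k => inord (m (val k))].
  have me : m = mono e.
    apply/mnmP => i; rewrite mnmE; case: insubP => [k _ <-|].
      by rewrite ffunE inordK // ltnS md.
    by rewrite negbK => /nA; rewrite -leqNgt leqn0 => /eqP.
  have := congr1 (fun M : 'rV_#|{: E}| => M 0 (enum_rank e)) vX.
  rewrite !mxE => vXe; rewrite raddf_sum -[RHS]vXe (reindex _ (onW_bij _ (@enum_val_bij J))) /=.
  by apply: eq_bigr => j' _; rewrite mcoeffZ mxE enum_valK enum_rankK -me.
case/eqP: v0; apply/rowP => j; by rewrite mxE -(enum_valK j) cE.
Qed.

(** A polynomial of degree [t] cannot dominate one of larger degree. *)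
Lemma pow_growth D k t : (forall N, N ^ k <= (D * N).+1 ^ t)%N -> (k <= t)%N.
Proof.
move=> h; rewrite leqNgt; apply/negP => tk.
(* For N > 0 the bound (D * N).+1 ^ t is at most D.+1 ^ t * N ^ t. *)
pose N := ((D.+1 ^ t).+1)%N.
have : (N ^ t.+1 <= D.+1 ^ t * N ^ t)%N.
  apply: leq_trans (leq_pexp2l _ tk) _ => //.
  apply: leq_trans (h N) _; rewrite -expnMn.
  by case: (t) => // t'; rewrite leq_exp2r // mulSn -addn1 addnC leq_add2r.
rewrite expnS leq_pmul2r ?expn_gt0 // ltnn //.
Qed.

(** A prime above [I] contains the [X_i] with [i] in [A], whence the upper bound;
    the chain that starts at [coord_ideal A] reaches it. *)
Lemma quot_dim_coord I A : is_ideal I -> (forall i, i \in A -> exists k, I ('X_i ^+ k)) ->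
  I `<=` coord_ideal A -> quot_dim I = (n - #|A|)%N.
Proof.
move=> idI powI IA; apply: quot_dim_eq => //.
  by have [C chC C0] := coord_chain A; exists C; rewrite ?C0.
move=> e C chC IC0; have [D hD] := prime_chain_indep chC.
have prC := proj1 chC 0%N (leq0n _); have /is_primeP[idC _ _] := prC.
apply: (@pow_growth D) => N; have [J [b [<- degb indep]]] := hD N.
apply: (@card_indep_mod A (C 0%N)) indep degb => // i /powI[k /IC0]; exact: prime_exp.
Qed.

End MonomialQuotientDimension.

(** * The inequalities *)

Lemma ceil_half (k : nat) : Num.ceil (k%:R / 2 : rat) = (uphalf k)%:Z.
Proof.
have le_k : k%:R <= 2 * (uphalf k)%:R :> rat by rewrite -natrM ler_nat; lia.
have ge_k : 2 * (uphalf k)%:R <= k%:R + 1 :> rat by rewrite -natrM natr1 ler_nat; lia.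
apply/le_anti/andP; split; first by rewrite ceil_le_int -pmulrn; lra.
by rewrite -ltzD1 -ltrBlDr ceil_gt_int rmorphB /= -pmulrn; lra.
Qed.

Theorem theorem4p5 (K : fieldType) (n : nat) (Q Q' : set {mpoly K[n]})
    (hQ : irreducible_monomial_ideal Q) (hQ' : irreducible_monomial_ideal Q')
    (Q_neq0 : Q <> [set 0]) (Q'_neq0 : Q' <> [set 0]) :
  let d := quot_dim Q in
  let d' := quot_dim Q' in
  let e := quot_dim (ideal_add Q Q') in
  let b : int := e%:Z + Num.ceil ((d'%:R - e%:R) / 2 : rat)
                      + Num.ceil ((d%:R - e%:R) / 2 : rat) in
  b <= (sdepth (Q `&` Q'))%:Z /\ Num.ceil ((d'%:R + d%:R) / 2 : rat) <= b.
Proof.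
case: hQ => A [a [a_gt0 QE]]; case: hQ' => B [b [b_gt0 Q'E]] d d' e.
have idQ : is_ideal Q by rewrite QE; apply: is_ideal_gen.
have idQ' : is_ideal Q' by rewrite Q'E; apply: is_ideal_gen.
have powQ i : i \in A -> Q ('X_i ^+ a i).
  by move=> iA; rewrite QE; apply: sub_gen_smallest; exists i.
have powQ' i : i \in B -> Q' ('X_i ^+ b i).
  by move=> iB; rewrite Q'E; apply: sub_gen_smallest; exists i.
have subQ : Q `<=` coord_ideal A by rewrite QE; apply: ideal_gen_powers_sub.
have subQ' : Q' `<=` coord_ideal B by rewrite Q'E; apply: ideal_gen_powers_sub.
have dE : d = (n - #|A|)%N.
  by apply: quot_dim_coord => // i /powQ; exists (a i).
have d'E : d' = (n - #|B|)%N.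
  by apply: quot_dim_coord => // i /powQ'; exists (b i).
have eE : e = (n - #|A :|: B|)%N.
  apply: quot_dim_coord => [|i|_ [u /subQ uA [v /subQ' vB <-]]].
  - exact: is_ideal_add.
  - rewrite inE => /orP[/powQ Qi|/powQ' Qi]; [exists (a i)|exists (b i)].
      by exists ('X_i ^+ a i) => //; exists 0; [case: idQ'|rewrite addr0].
    by exists 0; [case: idQ|exists ('X_i ^+ b i); rewrite ?add0r].
  - by apply: idealD (coord_ideal_is_ideal _ _) _ _;
      [apply: coord_ideal_mono uA|apply: coord_ideal_mono vB]; rewrite ?subsetUl ?subsetUr.
have cardU1 : (d' = e + #|A :\: B|)%N.
  rewrite d'E eE.
  have := cardsUI A B; have := cardsID B A; have := cardsC (A :|: B); rewrite card_ord.
  lia.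
have cardU2 : (d = e + #|B :\: A|)%N.
  rewrite dE eE.
  have := cardsUI A B; have := cardsID A B; have := cardsC (A :|: B); rewrite card_ord setIC.
  lia.
have -> : d'%:R - e%:R = #|A :\: B|%:R :> rat by rewrite cardU1 natrD addrC addKr.
have -> : d%:R - e%:R = #|B :\: A|%:R :> rat by rewrite cardU2 natrD addrC addKr.
rewrite -natrD !ceil_half; split; last by lia.
have -> : Q `&` Q' = supp_in [pred m | some_ge A a m && some_ge B b m].
  rewrite QE Q'E !ideal_gen_powersE; apply/seteqP; split=> f.
    by move=> [fA fB] m mf; rewrite /= fA ?fB.
  by move=> h; split=> m /h /andP[].
have := sdepth_some_ge_capI K A B a b; rewrite -eE; lia.
Qed.
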